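(* There is a 1-1 correspondence between strict $2$-term difference $A_\infty$-algebras and crossed modules of difference algebras.
   Context: All vector spaces are over a field $\mathbf{k}$ of characteristic $0$. **Difference algebras and bimodules.** A difference algebra $(A,d)$ is an associative algebra $A$ with a linear map $d:A\to A$ satisfying $d(ab)=d(a)b+ad(b)+d(a)d(b)$ for $a,b\in A$. A homomorphism $(A,d)\to(A',d')$ is an associative algebra homomorphism $\varphi:A\to A'$ with $d'\circ\varphi=\varphi\circ d$. A bimodule over $(A,d)$ is a pair $(M,\Delta)$ of an $A$-bimodule $M$ and a linear map $\Delta:M\to M$ with $\Delta(au)=d(a)u+a\Delta(u)+d(a)\Delta(u)$ and $\Delta(ua)=\Delta(u)a+ud(a)+\Delta(u)d(a)$ for $a\in A,u\in M$. **Crossed modules.** A crossed module of difference algebras is a triple $((A,d),(A',d'),\partial)$, where $(A,d)$ and $(A',d')$ are both difference algebras, $(A',d')$ is also a bimodule over the difference algebra $(A,d)$, and $\partial:A'\to A$ is a homomorphism of difference algebras such that for all $a\in A$, $h,k\in A'$ (multiplications of $A$ and $A'$ and the left and right $A$-actions on $A'$ all written by juxtaposition) $$a(hk)=(ah)k,\qquad h(ak)=(ha)k,\qquad h(ka)=(hk)a,$$ $$\partial(ah)=a\partial(h),\qquad\partial(ha)=\partial(h)a,\qquad\partial(h)k=h\partial(k)=hk.$$ **2-term difference $A_\infty$-algebras.** A $2$-term $A_\infty$-algebra $\mathfrak{a}=(A_1\xrightarrow{\delta}A_0,\odot,\mu)$ consists of a $2$-term complex $A_1\xrightarrow{\delta}A_0$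 (a linear map of vector spaces), bilinear maps $\odot:A_i\times A_j\to A_{i+j}$ ($0\le i+j\le1$) and a trilinear map $\mu:A_0\times A_0\times A_0\to A_1$ such that for all $x,y,z,t\in A_0$, $h,k\in A_1$: (A1) $\delta(x\odot h)=x\odot\delta(h)$; (A2) $\delta(h\odot x)=\delta(h)\odot x$; (A3) $\delta(h)\odot k=h\odot\delta(k)$; (A4) $x\odot(y\odot z)-(x\odot y)\odot z=\delta(\mu(x,y,z))$; (A5) $x\odot(y\odot h)-(x\odot y)\odot h=\mu(x,y,\delta(h))$; (A6) $x\odot(h\odot y)-(x\odot h)\odot y=\mu(x,\delta(h),y)$; (A7) $h\odot(x\odot y)-(h\odot x)\odot y=\mu(\delta(h),x,y)$; (A8) $x\odot\mu(y,z,t)-\mu(x\odot y,z,t)+\mu(x,y\odot z,t)-\mu(x,y,z\odot t)+\mu(x,y,z)\odot t=0$. A difference operator on $\mathfrak{a}$ is a triple $\mathfrak{d}=(d_0,d_1,d_2)$ of linear maps $d_0:A_0\to A_0$, $d_1:A_1\to A_1$ with $d_0\circ\delta=\delta\circ d_1$ and a bilinear map $d_2:A_0\times A_0\to A_1$ such that for all $x,y,z\in A_0$, $h\in A_1$: (D1) $d_0(x)\odot y+x\odot d_0(y)+d_0(x)\odot d_0(y)-d_0(x\odot y)=\delta(d_2(x,y))$; (D2) $d_0(x)\odot h+x\odot d_1(h)+d_0(x)\odot d_1(h)-d_1(x\odot h)=d_2(x,\delta(h))$; (D3) $d_1(h)\odot x+h\odot d_0(x)+d_1(h)\odot d_0(x)-d_1(h\odot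 x)=d_2(\delta(h),x)$; (D4) $(x+d_0(x))\odot d_2(y,z)-d_2(x\odot y,z)+d_2(x,y\odot z)-d_2(x,y)\odot(z+d_0(z))=\mu(d_0(x),y,z)+\mu(x,d_0(y),z)+\mu(x,y,d_0(z))+\mu(d_0(x),d_0(y),z)+\mu(d_0(x),y,d_0(z))+\mu(x,d_0(y),d_0(z))+\mu(d_0(x),d_0(y),d_0(z))-d_1(\mu(x,y,z))$. The pair $(\mathfrak{a},\mathfrak{d})$ is a $2$-term difference $A_\infty$-algebra; it is *strict* if $\mu=0$ and $d_2=0$. *)

(* Defs.v *)
From HB Require Import structures.
From mathcomp Require Import all_boot all_order all_algebra.

Set Implicit Arguments.
Unset Strict Implicit.
Unset Printing Implicit Defensive.

Import GRing.Theory.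
Local Open Scope ring_scope.

(* Vector spaces over k are the objects of type [lmodType k].  Associative
   algebras are not required to be unital, so MathComp's [algType] (which has
   a unit) is not used. *)

Section Definitions.
Variable k : fieldType.

Record diffAlgebra := DiffAlgebra {
  da_sort :> lmodType k;
  da_mul : {bilinear da_sort -> da_sort -> da_sort};
  da_d : {linear da_sort -> da_sort};
  da_mulA : forall a b c, da_mul a (da_mul b c) = da_mul (da_mul a b) c;
  da_dM : forall a b,
    da_d (da_mul a b) =
    da_mul (da_d a) b + da_mul a (da_d b) + da_mul (da_d a) (da_d b)
}.

Arguments da_mul {_}.
Arguments da_d {_}.

Record diffHom (A B : diffAlgebra) := DiffHom {
  dh_fun :> {linear A -> B};
  dh_mul : forall a b, dh_fun (da_mul a b) = da_mul (dh_fun a) (dh_fun b);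
  dh_d : forall a, da_d (dh_fun a) = dh_fun (da_d a)
}.

Record bimodule (A : diffAlgebra) (M : lmodType k) := Bimodule {
  bm_l : {bilinear A -> M -> M};
  bm_r : {bilinear M -> A -> M};
  bm_lA : forall a b u, bm_l a (bm_l b u) = bm_l (da_mul a b) u;
  bm_lr : forall a u b, bm_l a (bm_r u b) = bm_r (bm_l a u) b;
  bm_rA : forall u a b, bm_r (bm_r u a) b = bm_r u (da_mul a b)
}.

(* [diff_bimodule BM Delta]: the pair (M, Delta) is a bimodule over the
   difference algebra (A, d). *)
Definition diff_bimodule (A : diffAlgebra) (M : lmodType k)
    (BM : bimodule A M) (Delta : {linear M -> M}) : Prop :=
  (forall (a : A) (u : M),
     Delta (bm_l BM a u) =
     bm_l BM (da_d a) u + bm_l BM a (Delta u) + bm_l BM (da_d a) (Delta u)) /\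
  (forall (u : M) (a : A),
     Delta (bm_r BM u a) =
     bm_r BM (Delta u) a + bm_r BM u (da_d a) + bm_r BM (Delta u) (da_d a)).

Record crossedModule := CrossedModule {
  cm_A : diffAlgebra;
  cm_A' : diffAlgebra;
  cm_bm : bimodule cm_A cm_A';
  cm_diff_bm : diff_bimodule cm_bm da_d;
  cm_partial : diffHom cm_A' cm_A;
  cm_lmul : forall (a : cm_A) (h h' : cm_A'),
    bm_l cm_bm a (da_mul h h') = da_mul (bm_l cm_bm a h) h';
  cm_mmul : forall (h : cm_A') (a : cm_A) (h' : cm_A'),
    da_mul h (bm_l cm_bm a h') = da_mul (bm_r cm_bm h a) h';
  cm_rmul : forall (h h' : cm_A') (a : cm_A),
    da_mul h (bm_r cm_bm h' a) = bm_r cm_bm (da_mul h h') a;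
  cm_partial_l : forall (a : cm_A) (h : cm_A'),
    cm_partial (bm_l cm_bm a h) = da_mul a (cm_partial h);
  cm_partial_r : forall (h : cm_A') (a : cm_A),
    cm_partial (bm_r cm_bm h a) = da_mul (cm_partial h) a;
  cm_peiffer_l : forall h h' : cm_A',
    bm_l cm_bm (cm_partial h) h' = da_mul h h';
  cm_peiffer_r : forall h h' : cm_A',
    bm_r cm_bm h (cm_partial h') = da_mul h h'
}.

Definition trilinear (U V W X : lmodType k) (f : U -> V -> W -> X) : Prop :=
  [/\ forall v w, linear (fun u => f u v w),
      forall u w, linear (fun v => f u v w)
    & forall u v, linear (fun w => f u v w)].

(* [ai_mij] is the component A_i x A_j -> A_(i+j) of the product. *)
Record twoTermAinf := TwoTermAinf {
  ai_0 : lmodType k;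
  ai_1 : lmodType k;
  ai_delta : {linear ai_1 -> ai_0};
  ai_m00 : {bilinear ai_0 -> ai_0 -> ai_0};
  ai_m01 : {bilinear ai_0 -> ai_1 -> ai_1};
  ai_m10 : {bilinear ai_1 -> ai_0 -> ai_1};
  ai_mu : ai_0 -> ai_0 -> ai_0 -> ai_1;
  ai_mu_trilinear : trilinear ai_mu;
  ai_A1 : forall x h, ai_delta (ai_m01 x h) = ai_m00 x (ai_delta h);
  ai_A2 : forall h x, ai_delta (ai_m10 h x) = ai_m00 (ai_delta h) x;
  ai_A3 : forall h h', ai_m01 (ai_delta h) h' = ai_m10 h (ai_delta h');
  ai_A4 : forall x y z,
    ai_m00 x (ai_m00 y z) - ai_m00 (ai_m00 x y) z = ai_delta (ai_mu x y z);
  ai_A5 : forall x y h,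
    ai_m01 x (ai_m01 y h) - ai_m01 (ai_m00 x y) h = ai_mu x y (ai_delta h);
  ai_A6 : forall x h y,
    ai_m01 x (ai_m10 h y) - ai_m10 (ai_m01 x h) y = ai_mu x (ai_delta h) y;
  ai_A7 : forall h x y,
    ai_m10 h (ai_m00 x y) - ai_m10 (ai_m10 h x) y = ai_mu (ai_delta h) x y;
  ai_A8 : forall x y z t,
    ai_m01 x (ai_mu y z t) - ai_mu (ai_m00 x y) z t + ai_mu x (ai_m00 y z) t
      - ai_mu x y (ai_m00 z t) + ai_m10 (ai_mu x y z) t = 0
}.

Arguments ai_delta {_}.
Arguments ai_m00 {_}.
Arguments ai_m01 {_}.
Arguments ai_m10 {_}.

Record diffOperator (a : twoTermAinf) := DiffOperator {
  do_0 : {linear ai_0 a -> ai_0 a};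
  do_1 : {linear ai_1 a -> ai_1 a};
  do_delta : forall h, do_0 (ai_delta h) = ai_delta (do_1 h);
  do_2 : {bilinear ai_0 a -> ai_0 a -> ai_1 a};
  do_D1 : forall x y,
    ai_m00 (do_0 x) y + ai_m00 x (do_0 y) + ai_m00 (do_0 x) (do_0 y)
      - do_0 (ai_m00 x y) = ai_delta (do_2 x y);
  do_D2 : forall x h,
    ai_m01 (do_0 x) h + ai_m01 x (do_1 h) + ai_m01 (do_0 x) (do_1 h)
      - do_1 (ai_m01 x h) = do_2 x (ai_delta h);
  do_D3 : forall h x,
    ai_m10 (do_1 h) x + ai_m10 h (do_0 x) + ai_m10 (do_1 h) (do_0 x)
      - do_1 (ai_m10 h x) = do_2 (ai_delta h) x;
  do_D4 : forall x y z,
    ai_m01 (x + do_0 x) (do_2 y z) - do_2 (ai_m00 x y) z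
      + do_2 x (ai_m00 y z) - ai_m10 (do_2 x y) (z + do_0 z) =
    ai_mu (do_0 x) y z + ai_mu x (do_0 y) z + ai_mu x y (do_0 z)
      + ai_mu (do_0 x) (do_0 y) z + ai_mu (do_0 x) y (do_0 z)
      + ai_mu x (do_0 y) (do_0 z) + ai_mu (do_0 x) (do_0 y) (do_0 z)
      - do_1 (ai_mu x y z)
}.

Record twoTermDiffAinf := TwoTermDiffAinf {
  td_alg :> twoTermAinf;
  td_op : diffOperator td_alg
}.

Definition strict (X : twoTermDiffAinf) : Prop :=
  (forall x y z : ai_0 X, ai_mu x y z = 0) /\
  (forall x y : ai_0 X, do_2 (td_op X) x y = 0).

Definition strictTwoTermDiffAinf := {X : twoTermDiffAinf | strict X}.

(* The data (without axioms) common to a strict 2-term difference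
   A_oo-algebra and to a crossed module: the two vector spaces, the map
   between them, the product of degree 0, the left and right actions, and the
   two operators.  Bundling the spaces makes it possible to compare the data
   of two structures by a plain equality.  The product of the algebra A' of a
   crossed module is absent because the other data determine it:
   [da_mul h h' = bm_l (cm_partial h) h']. *)
Record twoTermData := TwoTermData {
  dt_0 : lmodType k;
  dt_1 : lmodType k;
  dt_delta : {linear dt_1 -> dt_0};
  dt_m00 : {bilinear dt_0 -> dt_0 -> dt_0};
  dt_m01 : {bilinear dt_0 -> dt_1 -> dt_1};
  dt_m10 : {bilinear dt_1 -> dt_0 -> dt_1};
  dt_d0 : {linear dt_0 -> dt_0};
  dt_d1 : {linear dt_1 -> dt_1}
}.

Definition data_of_ainf (X : twoTermDiffAinf) : twoTermData :=
  TwoTermData (@ai_delta X) (@ai_m00 X) (@ai_m01 X) (@ai_m10 X)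
    (do_0 (td_op X)) (do_1 (td_op X)).

Definition data_of_crossed (C : crossedModule) : twoTermData :=
  TwoTermData (cm_partial C) (@da_mul (cm_A C)) (bm_l (cm_bm C))
    (bm_r (cm_bm C)) (@da_d (cm_A C)) (@da_d (cm_A' C)).

End Definitions.

Arguments da_mul {k d}.
Arguments da_d {k d}.
Arguments ai_delta {k t0}.
Arguments ai_m00 {k t0}.
Arguments ai_m01 {k t0}.
Arguments ai_m10 {k t0}.

(* Main.v *)
Require Import Defs.
From HB Require Import structures.
From mathcomp Require Import all_boot all_order all_algebra.
From mathcomp Require Import boolp.

(** Both kinds of structure consist of the same data (two spaces, the map
    between them, a product, two actions, two operators) subject to the same
    axioms.  When [ai_mu] and [do_2] vanish, the homotopies [ai_A4]-[ai_A7] and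
    [do_D1]-[do_D3] become identities between the data, and the two coherence
    laws [ai_A8], [do_D4] become [0 = 0]; the remaining identities are collected
    in [strict_axioms].  A crossed module has one more operation, the product of
    [A'], but the Peiffer identity [partial(h) h' = h h'] leaves no choice for
    it.  Every axiom that involves this product is a consequence of the
    [strict_axioms], obtained by putting some [partial(h)] for an argument of
    degree [0].  For instance [A'] is associative because its elements act
    associatively through [partial], and [partial(h) partial(h')] is
    [partial(h h')] since [partial] commutes with the left action.

    Hence a strict 2-term difference A_oo-algebra, and likewise a crossed
    module, is the same thing as some [t : twoTermData] with a proof of
    [strict_axioms t].  Each of the two types has a rebuilding map
    [ainf_of_data], [crossed_of_data] from such pairs, and [ainf_of_dataK],
    [crossed_of_dataK] say that a structure is recovered from its own data.
    Rebuilding the data of one kind as a structure of the other kind therefore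
    gives two maps that are inverse to each other.  Equality of structures is
    Leibniz equality, so function extensionality and proof irrelevance enter
    in the comparison of the operations and of the proofs of the axioms. *)

Set Implicit Arguments.
Unset Strict Implicit.
Unset Printing Implicit Defensive.

Import GRing.Theory.
Local Open Scope ring_scope.

(** * Bilinear maps *)

Lemma bilinear_eq (k : fieldType) (U V W : lmodType k)
  (f g : {bilinear U -> V -> W}) : f =2 g -> f = g.
Proof.
move: f g => [f cf] [g cg] /= fg.
have {}fg : f = g by apply: funext => u; apply: funext => v; exact: fg.
rewrite -{}fg in cg *; congr Bilinear.Pack.
case: cf cg => [[a b c d]] [[a' b' c' d']].
by rewrite (Prop_irrelevance a a') (Prop_irrelevance b b')
  (Prop_irrelevance c c') (Prop_irrelevance d d').
Qed.

Section ZeroBilinear.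
Variables (k : fieldType) (U V W : lmodType k).

Definition zero_bilinear (_ : U) (_ : V) : W := 0.

Fact zero_bilinearP : bilinear_for *:%R *:%R zero_bilinear.
Proof. by split=> ? ? ? ?; rewrite /zero_bilinear /= scaler0 addr0. Qed.

HB.instance Definition _ :=
  bilinear_isBilinear.Build k U V W *:%R *:%R zero_bilinear zero_bilinearP.

End ZeroBilinear.

Section ProductThroughAction.
Variables (k : fieldType) (A M : lmodType k).
Variables (f : {linear M -> A}) (l : {bilinear A -> M -> M}).

(** The only product on [M] that is compatible with [f] and [l] in the sense of
    the Peiffer identity. *)
Definition peiffer_mul (h h' : M) : M := l (f h) h'.

Fact peiffer_mulP : bilinear_for *:%R *:%R peiffer_mul.
Proof.
split=> [h' | h] a x y; rewrite /peiffer_mul.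
- by rewrite linearP linearPl.
- by rewrite linearPr.
Qed.

HB.instance Definition _ :=
  bilinear_isBilinear.Build k M M M *:%R *:%R peiffer_mul peiffer_mulP.

End ProductThroughAction.

(** * The common axioms *)

Section CommonAxioms.
Variable k : fieldType.

(** The equations are oriented as in [diffAlgebra] and [bimodule], so that the
    fields can serve directly as the axioms of a crossed module. *)
Record strict_axioms (t : twoTermData k) : Prop := StrictAxioms {
  sa_delta_l : forall x h, dt_delta t (dt_m01 t x h) = dt_m00 t x (dt_delta t h);
  sa_delta_r : forall h x, dt_delta t (dt_m10 t h x) = dt_m00 t (dt_delta t h) x;
  sa_peiffer : forall h h',
    dt_m01 t (dt_delta t h) h' = dt_m10 t h (dt_delta t h');
  sa_mulA : forall x y z,
    dt_m00 t x (dt_m00 t y z) = dt_m00 t (dt_m00 t x y) z;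
  sa_lA : forall x y h, dt_m01 t x (dt_m01 t y h) = dt_m01 t (dt_m00 t x y) h;
  sa_lr : forall x h y, dt_m01 t x (dt_m10 t h y) = dt_m10 t (dt_m01 t x h) y;
  sa_rA : forall h x y, dt_m10 t (dt_m10 t h x) y = dt_m10 t h (dt_m00 t x y);
  sa_d_delta : forall h, dt_d0 t (dt_delta t h) = dt_delta t (dt_d1 t h);
  sa_dM : forall x y,
    dt_d0 t (dt_m00 t x y) =
    dt_m00 t (dt_d0 t x) y + dt_m00 t x (dt_d0 t y)
      + dt_m00 t (dt_d0 t x) (dt_d0 t y);
  sa_dl : forall x h,
    dt_d1 t (dt_m01 t x h) =
    dt_m01 t (dt_d0 t x) h + dt_m01 t x (dt_d1 t h)
      + dt_m01 t (dt_d0 t x) (dt_d1 t h);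
  sa_dr : forall h x,
    dt_d1 t (dt_m10 t h x) =
    dt_m10 t (dt_d1 t h) x + dt_m10 t h (dt_d0 t x)
      + dt_m10 t (dt_d1 t h) (dt_d0 t x)
}.

Lemma strict_axioms_of_ainf (X : strictTwoTermDiffAinf k) :
  strict_axioms (data_of_ainf (sval X)).
Proof.
case: X => -[a [d0 d1 ddelta d2 D1 D2 D3 D4]] [/= mu0 d20].
split=> /=.
- exact: ai_A1.
- exact: ai_A2.
- exact: ai_A3.
- by move=> x y z; apply: subr0_eq; rewrite ai_A4 mu0 linear0.
- by move=> x y h; apply: subr0_eq; rewrite ai_A5 mu0.
- by move=> x h y; apply: subr0_eq; rewrite ai_A6 mu0.
- by move=> h x y; apply/esym/subr0_eq; rewrite ai_A7 mu0.
- exact: ddelta.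
- by move=> x y; apply/esym/subr0_eq; rewrite D1 d20 linear0.
- by move=> x h; apply/esym/subr0_eq; rewrite D2 d20.
- by move=> h x; apply/esym/subr0_eq; rewrite D3 d20.
Qed.

Lemma strict_axioms_of_crossed (C : crossedModule k) :
  strict_axioms (data_of_crossed C).
Proof.
split=> /=.
- exact: cm_partial_l.
- exact: cm_partial_r.
- by move=> h h'; rewrite cm_peiffer_l cm_peiffer_r.
- exact: da_mulA.
- exact: bm_lA.
- exact: bm_lr.
- exact: bm_rA.
- exact: dh_d.
- exact: da_dM.
- exact: (cm_diff_bm C).1.
- exact: (cm_diff_bm C).2.
Qed.

(** * Strict algebras from their data *)

Section AinfOfData.
Variables (t : twoTermData k) (ax : strict_axioms t).

Let mu0 (x y z : dt_0 t) : dt_1 t := 0.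

Fact mu0_trilinear : trilinear mu0.
Proof. by split=> ? ? ? ? ?; rewrite /mu0 scaler0 addr0. Qed.

Fact mulA_mu0 x y z :
  dt_m00 t x (dt_m00 t y z) - dt_m00 t (dt_m00 t x y) z
    = dt_delta t (mu0 x y z).
Proof. by rewrite /mu0 linear0 (sa_mulA ax) subrr. Qed.

Fact lA_mu0 x y h :
  dt_m01 t x (dt_m01 t y h) - dt_m01 t (dt_m00 t x y) h = mu0 x y (dt_delta t h).
Proof. by rewrite (sa_lA ax) subrr. Qed.

Fact lr_mu0 x h y :
  dt_m01 t x (dt_m10 t h y) - dt_m10 t (dt_m01 t x h) y = mu0 x (dt_delta t h) y.
Proof. by rewrite (sa_lr ax) subrr. Qed.

Fact rA_mu0 h x y :
  dt_m10 t h (dt_m00 t x y) - dt_m10 t (dt_m10 t h x) y = mu0 (dt_delta t h) x y.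
Proof. by rewrite (sa_rA ax) subrr. Qed.

Fact cocycle_mu0 x y z w :
  dt_m01 t x (mu0 y z w) - mu0 (dt_m00 t x y) z w + mu0 x (dt_m00 t y z) w
    - mu0 x y (dt_m00 t z w) + dt_m10 t (mu0 x y z) w = 0.
Proof. by rewrite /mu0 linear0r linear0l !subr0 !addr0. Qed.

Definition ainf_alg_of_data : twoTermAinf k :=
  TwoTermAinf mu0_trilinear (sa_delta_l ax) (sa_delta_r ax) (sa_peiffer ax)
    mulA_mu0 lA_mu0 lr_mu0 rA_mu0 cocycle_mu0.

Let d20 : {bilinear dt_0 t -> dt_0 t -> dt_1 t} :=
  @zero_bilinear k (dt_0 t) (dt_0 t) (dt_1 t).

Fact dM_d20 x y :
  dt_m00 t (dt_d0 t x) y + dt_m00 t x (dt_d0 t y)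
      + dt_m00 t (dt_d0 t x) (dt_d0 t y) - dt_d0 t (dt_m00 t x y)
    = dt_delta t (d20 x y).
Proof. by rewrite (sa_dM ax) subrr linear0. Qed.

Fact dl_d20 x h :
  dt_m01 t (dt_d0 t x) h + dt_m01 t x (dt_d1 t h)
      + dt_m01 t (dt_d0 t x) (dt_d1 t h) - dt_d1 t (dt_m01 t x h)
    = d20 x (dt_delta t h).
Proof. by rewrite (sa_dl ax) subrr. Qed.

Fact dr_d20 h x :
  dt_m10 t (dt_d1 t h) x + dt_m10 t h (dt_d0 t x)
      + dt_m10 t (dt_d1 t h) (dt_d0 t x) - dt_d1 t (dt_m10 t h x)
    = d20 (dt_delta t h) x.
Proof. by rewrite (sa_dr ax) subrr. Qed.

Fact cocycle_d20 x y z :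
  dt_m01 t (x + dt_d0 t x) (d20 y z) - d20 (dt_m00 t x y) z
      + d20 x (dt_m00 t y z) - dt_m10 t (d20 x y) (z + dt_d0 t z) =
    mu0 (dt_d0 t x) y z + mu0 x (dt_d0 t y) z + mu0 x y (dt_d0 t z)
      + mu0 (dt_d0 t x) (dt_d0 t y) z + mu0 (dt_d0 t x) y (dt_d0 t z)
      + mu0 x (dt_d0 t y) (dt_d0 t z)
      + mu0 (dt_d0 t x) (dt_d0 t y) (dt_d0 t z) - dt_d1 t (mu0 x y z).
Proof.
by rewrite /d20 /= /zero_bilinear /mu0
  linear0r linear0l (linear0 (dt_d1 t)) !subr0 !addr0.
Qed.

Definition ainf_op_of_data : diffOperator ainf_alg_of_data :=
  @DiffOperator k ainf_alg_of_data (dt_d0 t) (dt_d1 t) (sa_d_delta ax) d20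
    dM_d20 dl_d20 dr_d20 cocycle_d20.

Definition ainf_of_data : strictTwoTermDiffAinf k :=
  exist _ (TwoTermDiffAinf ainf_op_of_data)
    (conj (fun _ _ _ => erefl) (fun _ _ => erefl)).

End AinfOfData.

(** Strictness determines the two components, [ai_mu] and [do_2], that the data
    omit. *)
Lemma ainf_of_dataK (X : strictTwoTermDiffAinf k)
  (ax : strict_axioms (data_of_ainf (sval X))) : ainf_of_data ax = X.
Proof.
suff E : sval (ainf_of_data ax) = sval X.
  by case: X ax E => X sX ax; exact: eq_exist.
case: X ax => -[[A0 A1 delta m00 m01 m10 mu mutri a1 a2 a3 a4 a5 a6 a7 a8] op].
case: op => d0 d1 ddelta d2 D1 D2 D3 D4 [/= mu0 d20] ax.
have Emu : mu = fun _ _ _ => 0.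
  by apply: funext => x; apply: funext => y; apply: funext => z; exact: mu0.
have Ed2 : d2 = @zero_bilinear k A0 A0 A1.
  by apply: bilinear_eq => x y; exact: d20.
(* The data are kept folded in [t], so that the goal shows the proofs of the
   axioms as proofs about [t]. *)
subst mu d2; set t := data_of_ainf _ in ax *.
rewrite /= /ainf_op_of_data /ainf_alg_of_data.
(* Both sides now differ only in the proofs of the axioms. *)
by rewrite (Prop_irrelevance (mu0_trilinear t) mutri)
  (Prop_irrelevance (sa_delta_l ax) a1) (Prop_irrelevance (sa_delta_r ax) a2)
  (Prop_irrelevance (sa_peiffer ax) a3) (Prop_irrelevance (mulA_mu0 ax) a4)
  (Prop_irrelevance (lA_mu0 ax) a5) (Prop_irrelevance (lr_mu0 ax) a6)
  (Prop_irrelevance (rA_mu0 ax) a7) (Prop_irrelevance (@cocycle_mu0 t) a8)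
  (Prop_irrelevance (sa_d_delta ax) ddelta) (Prop_irrelevance (dM_d20 ax) D1)
  (Prop_irrelevance (dl_d20 ax) D2) (Prop_irrelevance (dr_d20 ax) D3)
  (Prop_irrelevance (@cocycle_d20 t) D4).
Qed.

(** * Crossed modules from their data *)

Section CrossedOfData.
Variables (t : twoTermData k) (ax : strict_axioms t).

Definition base_of_data : diffAlgebra k :=
  DiffAlgebra (sa_mulA ax) (sa_dM ax).

Let mul := peiffer_mul (dt_delta t) (dt_m01 t).

Fact fibre_mulA h h' h'' : mul h (mul h' h'') = mul (mul h h') h''.
Proof. by rewrite /mul /peiffer_mul (sa_delta_l ax) (sa_lA ax). Qed.

Fact fibre_dM h h' :
  dt_d1 t (mul h h') =
  mul (dt_d1 t h) h' + mul h (dt_d1 t h') + mul (dt_d1 t h) (dt_d1 t h').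
Proof. by rewrite /mul /peiffer_mul (sa_dl ax) (sa_d_delta ax). Qed.

Definition fibre_of_data : diffAlgebra k :=
  @DiffAlgebra k (dt_1 t) mul (dt_d1 t) fibre_mulA fibre_dM.

Definition bimodule_of_data : bimodule base_of_data fibre_of_data :=
  @Bimodule k base_of_data fibre_of_data (dt_m01 t) (dt_m10 t)
    (sa_lA ax) (sa_lr ax) (sa_rA ax).

Fact partial_mul h h' :
  dt_delta t (mul h h') = dt_m00 t (dt_delta t h) (dt_delta t h').
Proof. exact: (sa_delta_l ax). Qed.

Definition partial_of_data : diffHom fibre_of_data base_of_data :=
  @DiffHom k fibre_of_data base_of_data (dt_delta t) partial_mul
    (sa_d_delta ax).

Fact fibre_lmul a h h' : dt_m01 t a (mul h h') = mul (dt_m01 t a h) h'.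
Proof. by rewrite /mul /peiffer_mul (sa_lA ax) (sa_delta_l ax). Qed.

Fact fibre_mmul h a h' : mul h (dt_m01 t a h') = mul (dt_m10 t h a) h'.
Proof. by rewrite /mul /peiffer_mul (sa_lA ax) (sa_delta_r ax). Qed.

Fact fibre_rmul h h' a : mul h (dt_m10 t h' a) = dt_m10 t (mul h h') a.
Proof. by rewrite /mul /peiffer_mul (sa_lr ax). Qed.

Fact fibre_peiffer_l h h' : dt_m01 t (dt_delta t h) h' = mul h h'.
Proof. by []. Qed.

Fact fibre_peiffer_r h h' : dt_m10 t h (dt_delta t h') = mul h h'.
Proof. by rewrite /mul /= /peiffer_mul (sa_peiffer ax). Qed.

Definition crossed_of_data : crossedModule k :=
  @CrossedModule k base_of_data fibre_of_data bimodule_of_data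
    (conj (sa_dl ax) (sa_dr ax)) partial_of_data fibre_lmul fibre_mmul
    fibre_rmul (sa_delta_l ax) (sa_delta_r ax) fibre_peiffer_l fibre_peiffer_r.

End CrossedOfData.

(** The product of [A'] is the one component that the data omit, and the Peiffer
    identity determines it. *)
Lemma crossed_of_dataK (C : crossedModule k)
  (ax : strict_axioms (data_of_crossed C)) : crossed_of_data ax = C.
Proof.
case: C ax => -[A m d mA dM] [M m' d' mA' dM'] [l r lA lr rA] dbm [f fM fd].
move=> lmul mmul rmul fl fr peiffer_l peiffer_r ax.
(* Until they are reduced, the types of [l], [r], [f] depend on [m'] through the
   carrier of the algebra, and [m'] could not be eliminated. *)
simpl in l, r, f.
have Em : m' = peiffer_mul f l.
  by apply: bilinear_eq => h h'; rewrite [LHS](esym (peiffer_l h h')).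
subst m'; set t := data_of_crossed _ in ax *.
rewrite /crossed_of_data /partial_of_data /bimodule_of_data /fibre_of_data
  /base_of_data.
(* Both sides now differ only in the proofs of the axioms. *)
by rewrite (Prop_irrelevance (sa_mulA ax) mA) (Prop_irrelevance (sa_dM ax) dM)
  (Prop_irrelevance (fibre_mulA ax) mA') (Prop_irrelevance (fibre_dM ax) dM')
  (Prop_irrelevance (sa_lA ax) lA) (Prop_irrelevance (sa_lr ax) lr)
  (Prop_irrelevance (sa_rA ax) rA) (Prop_irrelevance (partial_mul ax) fM)
  (Prop_irrelevance (sa_d_delta ax) fd)
  (Prop_irrelevance (conj (sa_dl ax) (sa_dr ax)) dbm)
  (Prop_irrelevance (fibre_lmul ax) lmul)
  (Prop_irrelevance (fibre_mmul ax) mmul)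
  (Prop_irrelevance (fibre_rmul ax) rmul)
  (Prop_irrelevance (sa_delta_l ax) fl) (Prop_irrelevance (sa_delta_r ax) fr)
  (Prop_irrelevance (@fibre_peiffer_l t) peiffer_l)
  (Prop_irrelevance (fibre_peiffer_r ax) peiffer_r).
Qed.

End CommonAxioms.

Theorem theorem5p4 (k : fieldType) (char0 : [pchar k] =i pred0) :
  exists Phi : strictTwoTermDiffAinf k -> crossedModule k,
    bijective Phi /\
    forall X : strictTwoTermDiffAinf k,
      data_of_crossed (Phi X) = data_of_ainf (sval X).
Proof.
exists (fun X => crossed_of_data (strict_axioms_of_ainf X)).
split; last by [].
exists (fun C => ainf_of_data (strict_axioms_of_crossed C)) => [X | C].
- exact: (ainf_of_dataK (X := X)).
- exact: (crossed_of_dataK (C := C)).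
Qed.
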